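(* Let $p,r>2$ be distinct primes such that $(r^i-1,p)=1$ for every $0<i<p-1$. Let $G=G_{r,p}$. Then $G$ has no non-trivial unisingular irreducible representation over any field of characteristic $\ell\neq r$.
   Context: For distinct primes $p,r$, $G_{r,p}$ denotes the non-abelian group of minimal order among non-abelian groups of order $r^dp$ ($d\ge 1$) having a normal $r$-subgroup $A$ of index $p$. The group is unique up to isomorphism; $A$ is an elementary abelian $r$-group of rank $d$, where $d$ is the order of $r$ modulo $p$, and the conjugation action of $G$ on $A$ is irreducible (there is no non-trivial proper $G$-invariant subgroup of $A$). A representation $\phi$ of a finite group $G$ over a field is called unisingular if $\phi(g)$ has eigenvalue $1$ for every $g\in G$. $(a,b)$ denotes the greatest common divisor of integers $a,b$.
   Formalization: G_{r,p} is taken of minimal order among such groups with A abelian; without this the minimal group need not be unique (for p=5, r=3 it would be E x C_5 with E non-abelian of order 27) nor have A elementary abelian. *)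

(* Defs.v *)
From HB Require Import structures.
From mathcomp Require Import all_boot all_order all_algebra.
From mathcomp Require Import all_fingroup all_solvable all_field all_character.

Set Implicit Arguments.
Unset Strict Implicit.
Unset Printing Implicit Defensive.

Import GRing.Theory.
Local Open Scope ring_scope.

(* [A] has to be abelian for the minimal group below to be unique: once the    *)
(* order of r mod p is at least 3, the groups E * C_p with E non-abelian of    *)
(* order r^3 are non-abelian, have a normal r-subgroup of index p, and are no  *)
(* larger than the extension of C_p by the irreducible module of order r^d,    *)
(* d the order of r mod p, which is the group meant by G_{r,p}.                *)
Definition nonabelian_ext (r p : nat) (gT : finGroupType) (G : {group gT}) : Prop :=
  ~~ abelian G
  /\ exists (d : nat) (A : {group gT}),
      [/\ (0 < d)%N, #|G| = (r ^ d * p)%N, (A <| G)%g,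
          (r.-group A)%g /\ abelian A & #|G : A|%g = p].

(* [G] is (a copy of) G_{r,p}. *)
Definition is_Grp (r p : nat) (gT : finGroupType) (G : {group gT}) : Prop :=
  nonabelian_ext r p G
  /\ forall (hT : finGroupType) (H : {group hT}),
       nonabelian_ext r p H -> (#|G| <= #|H|)%N.

Definition unisingular (F : fieldType) (gT : finGroupType) (G : {group gT})
    (n : nat) (rG : mx_representation F G n) : Prop :=
  forall g : gT, g \in G -> eigenvalue (rG g) 1.

(* Main.v *)
(* Minimality of |G| among its own nonabelian subgroups B <g> forces A to be a  *)
(* minimal normal subgroup with C_A(g) = 1, where g has order p; hence p        *)
(* divides |A| - 1 and |A| >= r^(p-1). If A acts trivially on V, a vector fixed *)
(* by g is fixed by G. Otherwise the kernel K of A on a simple A-submodule W    *)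
(* has index r, by Schur, and an element a of A has no eigenvalue 1 as soon as  *)
(* no conjugate of a lies in K, by Clifford. Such an a exists: a is determined  *)
(* by its p cosets K a^(g^i), whose product is 1, and counting shows that every *)
(* p-tuple of elements of A / K with product 1 occurs; take                     *)
(* (c^2, c, ..., c, c^-p) with c a generator of A / K.                          *)

Require Import Defs.
From HB Require Import structures.
From mathcomp Require Import all_boot all_order all_algebra.
From mathcomp Require Import all_fingroup all_solvable all_field all_character.

Set Implicit Arguments.
Unset Strict Implicit.
Unset Printing Implicit Defensive.

Import GRing.Theory.
Local Open Scope ring_scope.

(** If [A] acts trivially, [irr_ker_eigen1] applies. Otherwise, by [Clifford_no_eigen1], it is
    enough to find [a] in [A] no conjugate of which fixes a simple [A]-submodule [W] pointwise, i.e.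
    lies in its pointwise stabilizer [K]. Such an [a] exists by counting ([exists_conj_notin]): the
    orbit of [a] under [g] has product 1, so [a] is determined by p - 1 of its cosets mod [K]. The
    condition on the powers of r forces |A| >= r^(p-1), the number of such tuples, so each of them
    occurs. *)

(** * Structure of the group, and an element all of whose conjugates avoid K *)

Section GroupTheory.

Local Open Scope group_scope.

Variable gT : finGroupType.
Implicit Types (A B G K : {group gT}) (g a : gT).

(** Supplies the competitors to which the minimality of |G| is applied. *)
Lemma nonabelian_ext_cycle (r p : nat) B g :
    prime r -> prime p -> p <> r -> r.-group B -> abelian B ->
    #[g] = p -> g \in 'N(B) -> ~~ (B \subset 'C[g]) ->
  nonabelian_ext r p (B <*> <[g]>).
Proof.
move=> pr_r pr_p neq_pr rB abB og nBg ncBg.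
have nB : <[g]> \subset 'N(B) by rewrite cycle_subG.
have ogP : #|<[g]>| = p by [].
have co : coprime #|B| #|<[g]>|.
  rewrite ogP (card_pgroup rB) coprimeXl // prime_coprime // dvdn_prime2 //.
  by apply/eqP=> e; apply: neq_pr.
have cH : #|B <*> <[g]>| = (#|B| * p)%N.
  by rewrite norm_joinEr // coprime_cardMg // ogP.
split.
  apply: contra ncBg => abH; rewrite -cent_cycle.
  exact: (centsS (joing_subr _ _) (subset_trans (joing_subl _ _) abH)).
exists (logn r #|B|), B; split=> //.
- rewrite lt0n; apply: contraNneq ncBg => l0.
  have /eqP : #|B| = 1%N by rewrite (card_pgroup rB) l0.
  by rewrite -trivg_card1 => /eqP->; rewrite sub1G.
- by rewrite cH {1}(card_pgroup rB).
- by rewrite /normal joing_subl join_subG normG.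
- by rewrite -divgS ?joing_subl // cH mulKn.
Qed.

(** Conjugation by [g] shifts the factors cyclically, and they commute. *)
Lemma conj_orbit_prod_cent A g a n :
    abelian A -> g \in 'N(A) -> a \in A -> #[g] = n.+1 ->
  \prod_(i < n.+1) a ^ (g ^+ i) \in 'C_A[g].
Proof.
move=> abA nAg Aa og.
have Ag i : a ^ (g ^+ i) \in A by rewrite memJ_norm ?groupX.
have Ap m (F : 'I_m -> nat) : \prod_(i < m) a ^ (g ^+ F i) \in A.
  by apply: group_prod.
rewrite inE Ap /=; apply/cent1P/commgP/conjg_fixP.
rewrite conjg_prod; under [LHS]eq_bigr => i _ do rewrite -conjgM -expgSr.
rewrite big_ord_recr [RHS]big_ord_recl /= -og expg_order expg0 conjg1.
exact: (centsP abA _ (Ap _ _) _ Aa).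
Qed.

(** The p-group generated by [g] acts on [A] with 1 as its only fixed point. *)
Lemma cent1_regular_dvd A g p :
  prime p -> #[g] = p -> g \in 'N(A) -> 'C_A[g] = 1 -> (p %| #|A| - 1)%N.
Proof.
move=> pr_p og nAg CA1; rewrite -eqn_mod_dvd ?cardG_gt0 //; apply/eqP.
have pg : p.-group <[g]> by rewrite /pgroup -orderE og pnat_id.
have actA : [acts <[g]>, on A | 'J] by rewrite astabsJ cycle_subG.
by rewrite (pgroup_fix_mod pg actA) afixJ cent_cycle CA1 cards1.
Qed.

Lemma is_Grp_minnormal (r p : nat) G :
    prime r -> prime p -> p <> r -> is_Grp r p G ->
  exists A g, [/\ minnormal A G, abelian A, r.-group A, A * <[g]> = G
    & 'C_A[g] = 1 /\ #[g] = p].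
Proof.
move=> pr_r pr_p neq_pr [[nabG [d [A [d0 oG nsAG [rA abA] iA]]]] minG].
have [g Gg og] : {g | g \in G & #[g] = p}.
  by apply: Cauchy => //; rewrite oG dvdn_mull.
have oA : #|A| = (r ^ d)%N.
  have := Lagrange (normal_sub nsAG); rewrite iA oG => /eqP.
  by rewrite eqn_pmul2r ?prime_gt0 // => /eqP.
have nAg : <[g]> \subset 'N(A).
  by rewrite cycle_subG (subsetP (normal_norm nsAG)).
have co : coprime #|A| #|<[g]>|.
  rewrite [#|<[g]>|]og oA coprimeXl // prime_coprime // dvdn_prime2 //.
  by apply/eqP=> e; apply: neq_pr.
have defG : A * <[g]> = G.
  apply/eqP; rewrite eqEcard mul_subG ?cycle_subG ?(normal_sub nsAG) //=.
  by rewrite coprime_cardMg // [#|<[g]>|]og oA oG.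
have ncAg : ~~ (A \subset 'C[g]).
  apply: contra nabG; rewrite -cent_cycle => cAg.
  by rewrite -defG abelianM abA cycle_abelian /= centsC.
(* Minimality gives |A| p <= |B| p. *)
have subA_eq B : B \subset A -> g \in 'N(B) -> ~~ (B \subset 'C[g]) -> B :=: A.
  move=> sBA nBg ncBg; apply/eqP; rewrite eqEcard sBA.
  have rB := pgroupS sBA rA; have abB := abelianS sBA abA.
  have := minG _ _ (nonabelian_ext_cycle pr_r pr_p neq_pr rB abB og nBg ncBg).
  rewrite /= norm_joinEr ?cycle_subG // coprime_cardMg ?(coprimeSg sBA) //.
  by rewrite -defG coprime_cardMg // leq_pmul2r.
(* By coprime action, [A, g] meets C_A(g) trivially. So [g] does not centralize [A, g], which is
   therefore all of [A], and C_A(g) = 1. *)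
have TI := coprime_abel_cent_TI nAg co abA.
have defA : [~: A, <[g]>] :=: A.
  apply: subA_eq; first by rewrite commg_subl.
    rewrite -cycle_subG; exact: commg_normr.
  apply: contra ncAg; rewrite -cent_cycle => cB.
  have B1 : [~: A, <[g]>] = 1.
    by apply/trivgP; rewrite -TI subsetI subxx.
  exact/commG1P.
have C1 : 'C_A[g] = 1 by rewrite -cent_cycle -TI defA.
exists A, g; split=> //.
apply/mingroupP; split.
  rewrite normal_norm // andbT.
  by apply: contraNneq ncAg => ->; rewrite sub1G.
move=> B /andP[ntB nBG] sBA; apply: subA_eq => //.
  exact: (subsetP nBG).
apply: contra ntB => cB; apply/eqP/trivgP.
by rewrite -C1 subsetI sBA.
Qed.

Lemma exists_conj_notin (r n : nat) A G K g :
    prime r -> (2 < r)%N -> prime n.+1 -> n.+1 <> r ->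
    minnormal A G -> abelian A -> A * <[g]> = G -> 'C_A[g] = 1 ->
    #[g] = n.+1 -> (r ^ n <= #|A|)%N -> K \subset A -> #|A / K| = r ->
  exists2 a, a \in A & {in G, forall x, a ^ x \notin K}.
Proof.
move=> pr_r r_gt2 pr_n neq_nr minA abA defG CA1 og leA sKA oAK.
have [/andP[ntA nAG] minA'] := mingroupP minA.
have sAG : A \subset G by rewrite -defG mulG_subl.
have Gg : g \in G by rewrite -defG (subsetP (mulG_subr _ _)) ?cycle_id.
have nAg : g \in 'N(A) by apply: (subsetP nAG).
have nKA : A \subset 'N(K) by rewrite sub_abelian_norm.
have Ag a i : a \in A -> a ^ (g ^+ i) \in A.
  by move=> Aa; rewrite memJ_norm ?groupX.
have prod1 a : a \in A -> \prod_(i < n.+1) a ^ (g ^+ i) = 1.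
  move=> Aa; apply/set1gP; rewrite -CA1; exact: conj_orbit_prod_cent.
have conjG a x : a \in A -> x \in G ->
    exists2 i, (i < n.+1)%N & a ^ x = a ^ (g ^+ i).
  rewrite -defG => Aa /mulsgP[b _ Ab /cyclePmin[i lti ->] ->].
  rewrite og in lti; exists i; rewrite // conjgM (conjgE a b).
  by rewrite (centsP abA _ Aa _ Ab) mulKg.
have prodK a : a \in A -> \prod_(i < n.+1) coset K (a ^ (g ^+ i)) = 1.
  move=> Aa; rewrite -morph_prod ?prod1 ?morph1 // => i _.
  by apply: (subsetP nKA); apply: Ag.
(* The core of [K] is normal in [G] and proper in the minimal normal [A], since A / K has order r >
   1. *)
have core1 a : a \in A -> {in G, forall x, a ^ x \in K} -> a = 1.
  move=> Aa Ka; apply/set1gP; have: a \in gcore K G.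
    by apply/bigcapP=> x Gx; rewrite mem_conjg Ka ?groupV.
  suff /eqP-> : gcore K G == 1 by [].
  apply: contraTT isT => nt1.
  have eA : gcore K G = A.
    apply: minA'; first by rewrite nt1 gcore_norm.
    exact: subset_trans (gcore_sub _ _) sKA.
  have /quotientS1 AK1 : A \subset K by rewrite -eA gcore_sub.
  by move: r_gt2; rewrite -oAK AK1 cards1.
(* Only n = p - 1 of the p cosets are recorded; [prodK] recovers the last one. *)
pose f a := [ffun i : 'I_n => coset K (a ^ (g ^+ i))].
have injf : {in A &, injective f}.
  move=> a b Aa Ab /ffunP eqf; apply/eqP; rewrite eq_mulgV1; apply/eqP.
  have Aab : a * b^-1 \in A by rewrite groupM ?groupV.
  apply: core1 => // x Gx; have [i lti ->] := conjG _ _ Aab Gx.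
  have NK c j : c \in A -> c ^ (g ^+ j) \in 'N(K).
    by move=> Ac; apply/(subsetP nKA)/Ag.
  have eqc (j : 'I_n) : coset K (a ^ (g ^+ j)) = coset K (b ^ (g ^+ j)).
    by have := eqf j; rewrite !ffunE.
  have eqci : coset K (a ^ (g ^+ i)) = coset K (b ^ (g ^+ i)).
    move: lti; rewrite ltnS leq_eqVlt => /predU1P[-> | lti]; last first.
      exact: (eqc (Ordinal lti)).
    have := etrans (prodK a Aa) (esym (prodK b Ab)).
    by rewrite !big_ord_recr /= (eq_bigr _ (fun j _ => eqc j)); move/mulgI.
  rewrite coset_idr ?NK // conjMg conjVg morphM ?groupV ?NK //.
  by rewrite morphV ?NK //= eqci mulgV.
have imf : f @: A = [set h in ffun_on (mem (A / K))].
  apply/eqP; rewrite eqEcard; apply/andP; split.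
    apply/subsetP=> _ /imsetP[a Aa ->]; rewrite inE; apply/ffun_onP=> i.
    by rewrite ffunE mem_quotient ?Ag.
  by rewrite (card_in_imset injf) cardsE card_ffun_on oAK card_ord.
have /cyclicP[c defAK] : cyclic (A / K) by rewrite prime_cyclic ?oAK.
have oc : #[c] = r by rewrite orderE -defAK oAK.
(* This is (c^2, c, ..., c): the entries are non-trivial because r > 2. They multiply to c^p, so the
   unrecorded coset is c^-p, non-trivial because p differs from r. *)
pose h := [ffun i : 'I_n => c ^+ (val i == 0%N).+1].
have : h \in f @: A.
  by rewrite imf inE; apply/ffun_onP=> i; rewrite ffunE defAK mem_cycle.
case/imsetP=> a Aa /ffunP eqh; exists a => // x Gx.
have [i lti ->] := conjG _ _ Aa Gx; apply: contraTN isT => Ki.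
have {}eqh (j : 'I_n) : coset K (a ^ (g ^+ j)) = h j by rewrite eqh ffunE.
move: lti; rewrite ltnS leq_eqVlt => /predU1P[eqi | lti]; last first.
  have := eqh (Ordinal lti); rewrite coset_id // ffunE => /esym/eqP.
  rewrite -order_dvdn oc; move/dvdn_leq; case: eqP => _ /(_ isT).
    by rewrite leqNgt r_gt2.
  by rewrite leqNgt ltnW.
rewrite {}eqi in Ki; have := prodK a Aa.
rewrite big_ord_recr /= (coset_id Ki) mulg1.
under eq_bigr do rewrite eqh ffunE.
case: n pr_n neq_nr {Ki eqh h imf injf f prodK prod1 leA og conjG} => [//|m].
move=> pr_m neq_mr.
rewrite big_ord_recl /= big_const_ord iter_mulg mulg1 -expgD => /eqP.
rewrite -order_dvdn oc dvdn_prime2 // => /eqP er.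
by case: neq_mr; rewrite er.
Qed.
End GroupTheory.

(** * Fixed vectors and Clifford theory for a normal subgroup *)

Section Representations.

Variables (F : fieldType) (gT : finGroupType).
Implicit Types (A G : {group gT}).

Lemma irr_rfix0 G A n (rG : mx_representation F G n) :
    mx_irreducible rG -> (A <| G)%g -> ~~ (A \subset rker rG) ->
  rfix_mx rG A = 0.
Proof.
move=> /mx_irrP[_ irrG] nsAG; apply: contraNeq => nz.
have := irrG _ (normal_rfix_mx_module rG nsAG) nz.
rewrite -sub1mx => /rfix_mxP fixA; apply/subsetP=> a Aa.
by rewrite inE (subsetP (normal_sub nsAG)) //= !mul1mx -(fixA a Aa) mul1mx.
Qed.

Lemma irr_ker_eigen1 G A g n (rG : mx_representation F G n) :
    mx_irreducible rG -> (A * <[g]> = G)%g -> A \subset rker rG ->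
  eigenvalue (rG g) 1 -> G \subset rker rG.
Proof.
move=> irrG defG kA /eigenvalueP[u]; rewrite scale1r => gu nzu.
have Gg : g \in G by rewrite -defG (subsetP (mulG_subr _ _)) ?cycle_id.
apply: contraTT isT => ntG.
have fix0 := irr_rfix0 irrG (normal_refl G) ntG.
have : (u <= rfix_mx rG G)%MS.
  apply/rfix_mxP=> x Gx; suff /setIdP[_ /eqP] : x \in rstab rG u by [].
  apply: subsetP Gx; rewrite -defG mul_subG ?cycle_subG ?inE ?Gg ?gu //=.
  exact: subset_trans kA (rstabS _ (submx1 u)).
by rewrite fix0 submx0 (negPf nzu).
Qed.

(** Schur: [a - 1] commutes with the abelian group [A], so W (a - 1) is a non-zero submodule of the
    simple [W]. *)
Lemma mxsimple_abelian_sub1 A n (rA : mx_representation F A n) W a :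
    abelian A -> mxsimple rA W -> a \in A -> a \notin rstab rA W ->
  (W <= W *m (rA a - 1%:M))%MS.
Proof.
move=> abA [modW nzW simW] Aa nsta.
have modWa : mxmodule rA (W *m (rA a - 1%:M)).
  apply/mxmoduleP=> x Ax; rewrite -mulmxA.
  have -> : (rA a - 1%:M) *m rA x = rA x *m (rA a - 1%:M).
    rewrite mulmxBl mulmxBr -!repr_mxM // mul1mx mulmx1.
    by rewrite (centsP abA a Aa x Ax).
  by rewrite mulmxA submxMr ?(mxmoduleP modW).
apply: simW => //.
  by rewrite mulmxBr mulmx1 addmx_sub ?eqmx_opp ?(mxmoduleP modW).
by apply: contraNneq nsta => /eqP; rewrite mulmxBr mulmx1 subr_eq0 inE Aa.
Qed.

(* [a - 1] maps each translate [W x] onto itself, and these span by Clifford. *)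
Lemma Clifford_no_eigen1 G A n (rG : mx_representation F G n)
    (nsAG : (A <| G)%g) W a :
    mx_irreducible rG -> abelian A ->
    mxsimple (subg_repr rG (normal_sub nsAG)) W -> a \in A ->
    {in G, forall x, (a ^ x)%g \notin rstab rG W} ->
  ~~ eigenvalue (rG a) 1.
Proof.
move=> irrG abA simW Aa nsta; have sAG := normal_sub nsAG.
have Ga := subsetP sAG a Aa.
have : row_full (rG a - 1%:M).
  have [X sXG [defX _]] := Clifford_basis irrG simW.
  rewrite -sub1mx -defX; apply/sumsmx_subP=> x Xx.
  have Gx := subsetP sXG x Xx; have Gx' := groupVr Gx.
  (* On [W x], [a] acts as [a ^ x^-1] does on [W]. *)
  have Aax : (a ^ x^-1)%g \in A.
    by rewrite memJ_norm // (subsetP (normal_norm nsAG)).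
  have := mxsimple_abelian_sub1 abA simW Aax.
  rewrite rstab_subg inE Aax nsta //= => /(_ isT) sW.
  apply: submx_trans (submxMr (rG x) sW) _.
  rewrite -mulmxA mulmxBl mul1mx -repr_mxM ?groupJ // -conjgCV repr_mxM //.
  by rewrite -{2}[rG x]mulmx1 -mulmxBr mulmxA submxMl.
rewrite row_full_unit => u1; apply/eigenvalueP=> -[v].
rewrite scale1r => av; case/eqP.
by rewrite -(mulmxK u1 v) mulmxBr mulmx1 av subrr mul0mx.
Qed.

(** The quotient acts faithfully and irreducibly on [W], so its center is cyclic; being abelian, it
    is its own center. *)
Lemma mxsimple_rstab_cyclic A n (rA : mx_representation F A n) W :
    abelian A -> mxsimple rA W -> cyclic (A / rstab rA W)%g.
Proof.
move=> abA simW; have modW := mxsimple_module simW.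
have irrW := (submod_mx_irr modW).2 simW.
have := center_kquo_cyclic irrW; rewrite rker_submod.
by rewrite (center_idP (quotient_abelian _ abA)).
Qed.

End Representations.

Theorem lemma1p4 (p r : nat) (p_prime : prime p) (r_prime : prime r)
    (p_gt2 : (2 < p)%N) (r_gt2 : (2 < r)%N) (neq_pr : p <> r)
    (coprime_pr : forall i : nat, (0 < i < p - 1)%N -> coprime (r ^ i - 1) p)
    (gT : finGroupType) (G : {group gT}) (defG : is_Grp r p G)
    (F : fieldType) (charF : r \notin [pchar F])
    (n : nat) (rG : mx_representation F G n) :
  mx_irreducible rG -> ~~ (G \subset rker rG) -> ~ unisingular rG.
Proof.
move=> irrG ntG uniG.
have [A [g [minA abA rA defAG [CA1 og]]]] :=
  is_Grp_minnormal r_prime p_prime neq_pr defG.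
have [/andP[ntA nAG] _] := mingroupP minA.
have sAG : A \subset G by rewrite -defAG mulG_subl.
have nsAG : (A <| G)%g by rewrite /normal sAG.
have Gg : g \in G by rewrite -defAG (subsetP (mulG_subr _ _)) ?cycle_id.
have ncA : ~~ (A \subset rker rG).
  by apply: contra ntG => kA; apply: irr_ker_eigen1 irrG defAG kA (uniG g Gg).
have fixA0 := irr_rfix0 irrG nsAG ncA.
pose rHA := subg_repr rG (normal_sub nsAG).
have [_ nz1 _] := irrG.
(* Over an arbitrary field a simple submodule exists only classically, which requires a boolean
   goal. *)
suff: false by [].
apply: mxsimple_exists (mxmodule1 rHA) nz1 _ _ => -[W simW _].
have [_ nzW _] := simW.
pose K := rstab_group rHA W.
have sKA : K \subset A by rewrite /= rstab_subg subsetIl.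
(* A / K is cyclic and elementary abelian; it is not trivial, as [A] fixes no non-zero vector. *)
have oAK : #|(A / K)%g| = r.
  apply: cyclic_abelem_prime.
  - apply: quotient_abelem; rewrite -(is_abelem_pgroup rA).
    by have [] := minnormal_solvable minA (subxx A) (abelian_sol abA).
  - exact: mxsimple_rstab_cyclic abA simW.
  apply: contraNneq nzW => AK1; rewrite -submx0 -fixA0.
  have sAK : A \subset K.
    by rewrite -quotient_sub1 ?AK1 // sub_abelian_norm.
  by apply/rfix_mxP=> x Ax; have /setIdP[_ /eqP] := subsetP sAK x Ax.
(* p divides |A| - 1 = r^k - 1 with k > 0, which [coprime_pr] excludes for k < p - 1. *)
have leA : (r ^ p.-1 <= #|A|)%N.
  rewrite (card_pgroup rA) leq_exp2l ?(ltnW r_gt2) // leqNgt -subn1.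
  apply/negP=> ltlp; have : (0 < logn r #|A| < p - 1)%N.
    rewrite ltlp andbT lt0n; apply: contraNneq ntA => l0.
    by rewrite trivg_card1 (card_pgroup rA) l0.
  move/coprime_pr; rewrite -(card_pgroup rA) coprime_sym prime_coprime //.
  by rewrite (cent1_regular_dvd p_prime og (subsetP nAG g Gg) CA1).
have [a Aa nKa] : exists2 a, a \in A & {in G, forall x, (a ^ x)%g \notin K}.
  have Dp := prednK (prime_gt0 p_prime).
  by apply: (@exists_conj_notin gT r p.-1 A G K g) => //; rewrite Dp.
suff /negP : ~~ eigenvalue (rG a) 1 by case; apply/uniG/(subsetP sAG).
apply: (Clifford_no_eigen1 irrG abA simW Aa) => x Gx.
have := nKa x Gx.
by rewrite /= rstab_subg inE memJ_norm ?(subsetP nAG) // Aa.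
Qed.
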